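(* Let $U(X)=\sum_{n\ge 0}u_nX^n\in\mathbb{F}_2[[X]]$ be the compositional inverse of the generating function $D(X)=\sum_{n\ge 0}d_nX^n\in\mathbb{F}_2[[X]]$ of the period-doubling sequence, and let $(a_n)_{n\ge 0}$ be the increasing sequence with $\{a_n\mid n\in\mathbb{N}\}=\{m\in\mathbb{N}\mid u_m=1\}$. Then $(a_n)_{n\ge 0}$ is not $k$-regular for any integer $k\ge 2$.
   Context: $\mathbb{N}=\{0,1,2,\ldots\}$. The period-doubling sequence $(d_n)_{n\ge 0}$ is defined by $d_n=\nu_2(n+1)\bmod 2\in\{0,1\}$, where $\nu_2(m)$ is the exponent of the highest power of $2$ dividing $m$. The compositional inverse $U(X)$ is the series in $\mathbb{F}_2[[X]]$ with zero constant term such that $D(U(X))=X=U(D(X))$; it exists since $d_0=0$ and $d_1=1$. For an integer $k\ge 2$, the $k$-kernel of a sequence $(s_n)_{n\ge 0}$ is the set of subsequences $\{(s_{k^i n+r})_{n\ge 0}\mid i\ge 0,\ 0\le r<k^i\}$. An integer sequence is $k$-regular if there exists a finite set $S$ of (integer) sequences such that every sequence in its $k$-kernel is a $\mathbb{Z}$-linear combination of sequences of $S$. *)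

(* Defs.v *)
From HB Require Import structures.
From mathcomp Require Import all_boot all_order all_algebra.

Set Implicit Arguments.
Unset Strict Implicit.
Unset Printing Implicit Defensive.

Import GRing.Theory.

Local Open Scope ring_scope.

(* A formal power series over R is its sequence of coefficients; equality of
   series is pointwise equality [=1]. *)
Definition fps (R : comNzRingType) : Type := nat -> R.

Definition fps_one (R : comNzRingType) : fps R := fun n => (n == 0%N)%:R.

Definition fps_X (R : comNzRingType) : fps R := fun n => (n == 1%N)%:R.

Definition fps_mul (R : comNzRingType) (f g : fps R) : fps R :=
  fun n => \sum_(i < n.+1) f i * g (n - i)%N.

Definition fps_exp (R : comNzRingType) (f : fps R) (i : nat) : fps R :=
  iter i (fps_mul f) (fps_one R).

(* The series f(g(X)), meaningful only when g 0 = 0: then g ^ i has no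
   coefficient in degree n < i, so that the (a priori infinite) sum
   \sum_i f_i [X^n] g(X)^i stops at i = n. *)
Definition fps_comp (R : comNzRingType) (f g : fps R) : fps R :=
  fun n => \sum_(i < n.+1) f i * fps_exp g i n.

(* Intended for f with f 0 = 0, so that both compositions are meaningful. *)
Definition is_comp_inverse (R : comNzRingType) (f g : fps R) : Prop :=
  [/\ g 0%N = 0, fps_comp f g =1 fps_X R & fps_comp g f =1 fps_X R].

Definition period_doubling (n : nat) : nat := (logn 2 n.+1 %% 2)%N.

Definition period_doubling_series : fps 'F_2 :=
  fun n => (period_doubling n)%:R.

Definition in_kernel (T : Type) (k : nat) (s t : nat -> T) : Prop :=
  exists i r : nat, (r < k ^ i)%N /\ t =1 (fun n => s (k ^ i * n + r)%N).

(* The finite set of sequences is given as a finite family S_0, ..., S_(N-1). *)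
Definition k_regular (k : nat) (s : nat -> int) : Prop :=
  exists (N : nat) (S : 'I_N -> nat -> int),
    forall t : nat -> int, in_kernel k s t ->
      exists c : 'I_N -> int, forall n : nat, t n = \sum_(j < N) c j * S j n.

(* Main.v *)
Require Import Defs.
From HB Require Import structures.
From mathcomp Require Import all_boot all_order all_algebra.
From mathcomp Require Import zify ring.

Set Implicit Arguments.
Unset Strict Implicit.
Unset Printing Implicit Defensive.

Import GRing.Theory.

Local Open Scope ring_scope.

(** The residues of a_n modulo 3 are constant on blocks bounded by Fibonacci
    numbers, and regularity would force these blocks to be invariant under
    multiplication by an integer larger than 1, which they are not.

    The recursion d_(2n) = 0, d_(2n+1) = 1 + d_n in F_2 says that
    D = X D^2 + X / (1+X)^2; substituting U for X gives
    X = U X^2 + U / (1+U)^2, a cubic equation for U.  In terms of Z = 1 + X U,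
    that cubic becomes, after multiplication by X Z, the equation
    Z = Z^4 + X^2 Z^2 ([cons1_inverse_eq]).  Since the Frobenius map only
    spreads out coefficients, one reads off that Z is even and that
    w_n = [X^(2n)] Z is the characteristic sequence of the set W of integers
    whose binary expansion has all its runs of zeros of even length
    ([inverse_even_zero_runs]).  Hence a_n = 2 m - 1, where m is the element
    of index n+1 of W.

    The recursion of w gives two facts: W has fib (L+2) elements below 2^L
    ([count_pow2]), and an element of W is 0 or 1 modulo 3 according to the
    parity of the number of its binary digits ([mod3_parity_of_length]).
    Together they say that a_n mod 3 depends only on the parity of the L for
    which n+1 lies in the block from fib (L+2) to fib (L+3)
    ([inverse_enum_mod3]).

    If a were k-regular, the sequences n |-> a (k^i n) mod 3 would be finitely
    many, so a (B n) = a (B K n) mod 3 for some powers B and K > 1 of k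
    ([k_regular_mod]).  Comparing the block boundaries on both sides, every
    K fib j is within a bounded distance of some fib x ([fib_parity_rigid]).
    The growth of the Fibonacci numbers makes x increase by exactly 1 with j,
    so fib x - K fib j is a bounded solution of the Fibonacci recurrence in
    integers, hence 0; then K divides consecutive Fibonacci numbers, which are
    coprime ([fib_scale_rigid]). *)

(** * Power series modulo a power of X *)

Lemma dvdXn_coef (R : fieldType) N (p : {poly R}) :
  'X^N %| p <-> forall i, (i < N)%N -> p`_i = 0.
Proof.
split=> [/dvdpP[q ->] i ltiN | p0].
  by rewrite coefMXn ltiN.
have -> : p = drop_poly N p * 'X^N.
  rewrite -{1}(poly_take_drop N p) [take_poly N p](_ : _ = 0) ?add0r //.
  by apply/polyP=> i; rewrite coef_take_poly coef0; case: ifP => // /p0.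
exact: dvdp_mull.
Qed.

Lemma comp_poly_dvdXn (R : fieldType) N (f g : {poly R}) :
  g`_0 = 0 -> 'X^N %| f -> 'X^N %| f \Po g.
Proof.
move=> g0 /dvdpP[q ->]; rewrite comp_polyM comp_Xn_poly dvdp_mull //.
by apply: dvdp_exp2r; rewrite -['X]expr1; apply/dvdXn_coef => -[].
Qed.

(** Polynomials modulo X^N stand for power series because there composition
    is a ring morphism in its first argument. *)
Definition trunc (R : comNzRingType) N (f : fps R) : {poly R} :=
  \poly_(i < N) f i.

Lemma coef_trunc_exp (R : comNzRingType) N (f : fps R) i n :
  (n < N)%N -> (trunc N f ^+ i)`_n = fps_exp f i n.
Proof.
elim: i n => [|i IHi] n ltnN; first by rewrite expr0 coef1.
rewrite exprS coefM; apply: eq_bigr => j _.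
by rewrite coef_poly IHi; [rewrite ifT //|]; have := ltn_ord j; lia.
Qed.

Lemma coef_trunc_comp (R : fieldType) N (f g : fps R) n :
  g 0%N = 0 -> (n < N)%N -> (trunc N f \Po trunc N g)`_n = fps_comp f g n.
Proof.
move=> g0 ltnN; have t0 : (trunc N g)`_0 = 0 by rewrite coef_poly g0 if_same.
rewrite [trunc N f]poly_def linear_sum /= coef_sum.
transitivity (\sum_(i < N) f i * (trunc N g ^+ i)`_n).
  by apply: eq_bigr => i _; rewrite linearZ /= comp_Xn_poly coefZ.
rewrite -(big_mkord xpredT (fun i => f i * (trunc N g ^+ i)`_n)).
rewrite (big_cat_nat (n := n.+1)) //= [X in _ + X]big1_seq ?addr0.
  by rewrite big_mkord; apply: eq_bigr => i _; rewrite coef_trunc_exp.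
move=> i; rewrite mem_index_iota => /andP[_ /andP[ltni _]].
rewrite -comp_Xn_poly.
by have /dvdXn_coef-> := comp_poly_dvdXn t0 (dvdpp 'X^i); rewrite ?mulr0.
Qed.

(** * The algebraic equation of the inverse *)

(** Frobenius: the coefficients, being in F_2, are equal to their squares. *)
Lemma sqr_polyF2 (p : {poly 'F_2}) : p ^+ 2 = p \Po 'X^2.
Proof.
have ch : 2 \in [pchar {poly 'F_2}] by rewrite pchar_poly pchar_Fp.
rewrite comp_polyE -[p in LHS]coefK poly_def.
rewrite -[LHS]/(pFrobenius_aut ch _) rmorph_sum; apply: eq_bigr => i _.
rewrite /= pFrobenius_autE exprZn exprAC; congr (_ *: _).
by case: (p`_i) => -[|[|]] // ?; apply/val_inj.
Qed.

Lemma coef_sqr_polyF2 (p : {poly 'F_2}) n :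
  (p ^+ 2)`_n = if odd n then 0 else p`_n./2.
Proof.
by rewrite sqr_polyF2 coef_comp_poly_Xn // dvdn2 divn2; case: odd.
Qed.

Lemma period_doubling_series_even n : period_doubling_series n.*2 = 0.
Proof.
rewrite /period_doubling_series /period_doubling Fp_nat_mod //.
by rewrite lognE /= dvdn2 /= odd_double.
Qed.

Lemma period_doubling_series_odd n :
  period_doubling_series n.*2.+1 = 1 + period_doubling_series n.
Proof.
rewrite /period_doubling_series /period_doubling !Fp_nat_mod //.
rewrite -doubleS -mul2n lognM // logn_prime // eqxx.
by rewrite natrD.
Qed.

(** D = X D^2 + X / (1 + X)^2; the second summand collects the constant 1 in
    d_(2n+1) = 1 + d_n, and the constant series 1 stands for 1 / (1 + X). *)
Lemma period_doubling_eq N :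
  'X^N %| trunc N period_doubling_series -
    ('X * trunc N period_doubling_series ^+ 2 +
     'X * trunc N (fun=> 1 : 'F_2) ^+ 2).
Proof.
apply/dvdXn_coef => n ltnN.
rewrite coefB coefD !coefXM !coef_sqr_polyF2 !coef_poly ltnN.
case: n ltnN => [|n] ltnN /=.
  by rewrite (period_doubling_series_even 0) addr0 subrr.
have [on|en] := boolP (odd n).
  by rewrite -[n.+1]odd_double_half /= on period_doubling_series_even addr0 subrr.
rewrite ifT; last by lia.
have -> : n.+1 = (n./2).*2.+1 by lia.
rewrite period_doubling_series_odd ifT; last by lia.
by rewrite [1 + _]addrC subrr.
Qed.

(** The coefficient sequence of the series 1 + X u(X). *)
Definition cons1 (u : fps 'F_2) : fps 'F_2 :=
  fun n => if n is m.+1 then u m else 1.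

(** Composing the equation of D with U and clearing the denominator (1 + U)^2
    gives the cubic X (1+U)^2 = U X^2 (1+U)^2 + U.  Multiplying it by X (1 + X U)
    makes all exponents of Z = 1 + X U powers of 2, so that coefficients of Z
    can be compared directly. *)
Lemma cons1_inverse_eq (u : fps 'F_2) N :
  is_comp_inverse period_doubling_series u ->
  'X^N %| trunc N (cons1 u) -
    (trunc N (cons1 u) ^+ 4 + 'X^2 * trunc N (cons1 u) ^+ 2).
Proof.
move=> [u0 Du _]; set z := trunc N (cons1 u); pose p := trunc N u.
have p0 : p`_0 = 0 by rewrite coef_poly u0 if_same.
pose d := trunc N period_doubling_series.
pose g := trunc N (fun=> 1 : 'F_2).
have dp : 'X^N %| d \Po p - 'X.
  apply/dvdXn_coef => n ltnN; rewrite coefB coef_trunc_comp // Du coefX.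
  by rewrite /fps_X subrr.
have gp : 'X^N %| (1 - p) * (g \Po p) - 1.
  have: 'X^N %| (1 - 'X) * g - 1.
    rewrite /g /trunc poly_def (eq_bigr (fun i : 'I_N => 'X^i)); last first.
      by move=> i _; rewrite scale1r.
    rewrite -[1 - 'X]opprB mulNr -subrX1.
    by rewrite opprB addrAC subrr sub0r dvdpNr.
  move/(comp_poly_dvdXn p0).
  by rewrite !(rmorphB, rmorphM, rmorph1) /= comp_polyX.
have eqd := comp_poly_dvdXn p0 (period_doubling_eq N).
move: eqd; rewrite -/d -/g !(rmorphB, rmorphD, rmorphM, rmorphXn) /=.
rewrite comp_polyX => eqd.
set D := d \Po p in dp eqd; set G := g \Po p in gp eqd.
have zp : 'X^N %| z - (1 + 'X * p).
  apply/dvdXn_coef => -[|n] ltnN; rewrite coefB coefD coef1 coefXM !coef_poly.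
    by rewrite ltnN addr0 subrr.
  by rewrite ltnN (ltnW ltnN) add0r subrr.
have two0 : 2 = 0 :> {poly 'F_2}.
  by rewrite -[2]/(1 + 1) -polyC1 -polyCD -polyC0; congr _%:P; apply/val_inj.
pose t := 1 + 'X * p : {poly 'F_2}.
(* The cubic equation of U, with the signs that make it a combination of the
   relations above over any commutative ring. *)
pose c := (1 - p) ^+ 2 * ('X - p * 'X^2) - p : {poly 'F_2}.
have cubic : 'X^N %| c.
  have -> : c = (1 - p) ^+ 2 * ((D - (p * D ^+ 2 + p * G ^+ 2)) +
                                (p * (D + 'X) - 1) * (D - 'X))
                + p * (1 + (1 - p) * G) * ((1 - p) * G - 1).
    by rewrite /c; ring.
  apply: dvdp_add; apply: dvdp_mull => //.
  by apply: dvdp_add => //; apply: dvdp_mull.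
(* Over the integers, t - t^4 - X^2 t^2 and - t X c differ by - 2 r. *)
pose r := t * (2 * 'X * p + 'X^2 * p ^+ 2 + 'X^2 * p + 'X^3 * p ^+ 3 +
               'X^3 * p - 'X^3 * p ^+ 2).
have -> : z - (z ^+ 4 + 'X^2 * z ^+ 2) =
    (1 - (z ^+ 3 + z ^+ 2 * t + z * t ^+ 2 + t ^+ 3) - 'X^2 * (z + t)) * (z - t)
    - (t * 'X) * c - 2 * r.
  by rewrite /c /r /t; ring.
by rewrite two0 mul0r subr0; apply: dvdp_sub; apply: dvdp_mull.
Qed.

Lemma cons1_rec (u : fps 'F_2) n :
  is_comp_inverse period_doubling_series u ->
  cons1 u n = (if (4 %| n)%N then cons1 u (n %/ 4)%N else 0) +
              (if odd n || (n < 2)%N then 0 else cons1 u (n.-2)./2).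
Proof.
move/(cons1_inverse_eq n.+1)/dvdXn_coef/(_ n (ltnSn n))/eqP.
rewrite coefB subr_eq0 => /eqP; rewrite coefD (exprM _ 2 2) coefXnM.
rewrite !coef_sqr_polyF2 !coef_poly ltnSn => ->; congr (_ + _).
  have [on|en] := boolP (odd n); first by rewrite ifN //; lia.
  have [o2|e2] := boolP (odd n./2); first by rewrite ifN //; lia.
  rewrite !ifT; [congr (cons1 u _)| |]; lia.
have [lt2|ge2] := ltnP n 2; first by rewrite orbT.
rewrite orbF subn2 (_ : (n.-2./2 < n.+1)%N = true); last by lia.
by case: n ge2 => [|[|n]] //= _; rewrite negbK.
Qed.

(** Read from the least significant digit, this recursion pins down w: the
    characteristic sequence of the integers whose binary expansion (without
    leading zeros) has only runs of zeros of even length.  A final digit 1 or a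
    final pair 00 may be removed, a final 10 is forbidden. *)
Definition even_zero_runs (w : nat -> bool) : Prop :=
  [/\ w 0%N, forall n, w (2 * n + 1)%N = w n,
      forall n, w (4 * n)%N = w n & forall n, w (4 * n + 2)%N = false].

Lemma cons1_odd (u : fps 'F_2) n :
  is_comp_inverse period_doubling_series u -> odd n -> cons1 u n = 0.
Proof.
by move=> hu on; rewrite cons1_rec // on ifN ?addr0 //; lia.
Qed.

Lemma inverse_even_zero_runs (u : fps 'F_2) :
  is_comp_inverse period_doubling_series u ->
  even_zero_runs (fun n => cons1 u (2 * n)%N == 1).
Proof.
move=> hu; have z4 n : cons1 u (4 * n)%N = cons1 u n.
  rewrite cons1_rec // dvdn_mulr // mulKn //.
  case: n => [|n]; first by rewrite addr0.
  rewrite (_ : (4 * n.+1).-2./2 = (2 * n).+1)%N; last by lia.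
  by rewrite [cons1 u (2 * n).+1]cons1_odd ?if_same ?addr0 //; lia.
split=> [//|n|n|n].
- rewrite cons1_rec // ifN; last by lia.
  by rewrite add0r ifN; [congr (cons1 u _ == 1)|]; lia.
- by rewrite (_ : 2 * (4 * n) = 4 * (2 * n))%N ?z4 //; lia.
- rewrite (_ : 2 * (4 * n + 2) = 4 * (2 * n + 1))%N ?z4; last by lia.
  by rewrite cons1_odd //; lia.
Qed.

Local Open Scope nat_scope.

(** * Fibonacci numbers *)

Fixpoint fib n :=
  if n is n'.+1 then if n' is n''.+1 then fib n' + fib n'' else 1 else 0.

Arguments fib : simpl never.

Lemma fibSS n : fib n.+2 = fib n.+1 + fib n. Proof. by []. Qed.

Lemma fib_gt0 n : 0 < fib n.+1.
Proof. by elim: n => // n IHn; rewrite fibSS; lia. Qed.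

Lemma fib_leS n : fib n <= fib n.+1.
Proof. by case: n => // n; rewrite fibSS; lia. Qed.

Lemma fib_homo : {homo fib : m n / m <= n}.
Proof. exact: (homo_leq leqnn leq_trans fib_leS). Qed.

Lemma fib_large n : n <= fib n.+1.
Proof.
elim/ltn_ind: n => -[|[|[|n]]] // IHn; rewrite fibSS.
have := IHn n.+2 (ltnSn _); have := fib_gt0 n.+1; lia.
Qed.

Lemma coprime_fib n : coprime (fib n) (fib n.+1).
Proof.
elim: n => // n IHn.
by rewrite fibSS /coprime gcdnDl -/(coprime _ _) coprime_sym.
Qed.

Lemma fib_level m : 0 < m -> exists L, fib L.+2 <= m < fib L.+3.
Proof.
move=> m_gt0; have ex : exists L, m < fib L.+2 by exists m; apply: fib_large m.+1.
case: (ex_minnP ex) => -[|L] ltm min; first by case: m m_gt0 ltm {ex min}.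
exists L; rewrite ltm andbT leqNgt; apply/negP => /min.
by rewrite ltnn.
Qed.

(** * Binary expansions with even runs of zeros *)

(** Below 4 M, the odd elements come from elements below 2 M and the even ones
    from elements below M; for M a power of 2 this is the Fibonacci recurrence. *)
Lemma count_mul4 w M : even_zero_runs w ->
  \sum_(m < 4 * M) w m = \sum_(m < 2 * M) w m + \sum_(m < M) w m.
Proof.
case=> w0 w1 w4 w2; elim: M => [|M IHM]; first by rewrite !big_ord0.
rewrite !mulnS !addSn !add0n !big_ord_recr /= IHM.
have -> : w (4 * M).+1 = w (2 * M) by rewrite -[RHS]w1; congr w; lia.
have -> : w (4 * M).+3 = w (2 * M).+1 by rewrite -[RHS]w1; congr w; lia.
by rewrite w4 -[(4 * M).+2]addn2 w2 addn0; ring.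
Qed.

Lemma count_pow2 w L : even_zero_runs w ->
  \sum_(m < 2 ^ L) w m = fib L.+2.
Proof.
move=> ss; have [w0 w1 _ _] := ss; elim/ltn_ind: L => -[|[|L]] IHL.
- by rewrite big_ord1 w0.
- by rewrite !big_ord_recr big_ord0 /= w0 (w1 0) w0.
- rewrite 2!expnS mulnA count_mul4 // -expnS fibSS.
  by rewrite (IHL L.+1) // (IHL L) //; lia.
Qed.

(** Appending the digit 1 maps n to 2 n + 1, which exchanges the residues 0 and
    1 modulo 3, and appending 00 maps n to 4 n, which fixes them. *)
Lemma mod3_parity_of_length w L n : even_zero_runs w ->
  w n -> 2 ^ L <= n < 2 ^ L.+1 -> n %% 3 = ~~ odd L.
Proof.
case=> _ w1 w4 w2; elim/ltn_ind: L n => -[|L] IHL n wn.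
  by case: n wn => [|[|n]].
rewrite !expnS => bn; have [on|en] := boolP (odd n).
  have E : n = 2 * n./2 + 1 by lia.
  have := IHL L (ltnSn _) n./2; rewrite -w1 -E ?expnS => /(_ wn).
  move=> h; have {}h : n./2 %% 3 = ~~ odd L by apply: h; lia.
  by rewrite oddS negbK; case: (odd L) h => /=; lia.
have [o2|e2] := boolP (odd n./2).
  by move: wn; rewrite (_ : n = 4 * (n %/ 4) + 2) ?w2; lia.
have E : n = 4 * (n %/ 4) by lia.
case: L => [|L] in IHL bn *; first by lia.
have := IHL L (leqnSn _) (n %/ 4); rewrite -w4 -E ?expnS => /(_ wn) h.
have {}h : n %/ 4 %% 3 = ~~ odd L by apply: h; rewrite ?expnS in bn; lia.
by rewrite /= negbK -h; lia.
Qed.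

(** * The enumeration of the support of the inverse *)

Lemma leq_enum (a : nat -> nat) (A : pred nat) :
  {homo a : m n / m < n} ->
  (forall m : nat, (exists n : nat, a n = m) <-> A m) ->
  forall N n, (a n < N) = (n < \sum_(m < N) A m).
Proof.
move=> a_incr a_range; elim=> [|N IHN] n; first by rewrite big_ord0.
have leE := leq_mono a_incr.
rewrite big_ord_recr /=; have [AN|nAN] := boolP (A N); last first.
  rewrite addn0 -IHN ltnS leq_eqVlt; case: eqP => //= anN.
  by case/negP: nAN; apply/a_range; exists n.
have [n1 an1] := (a_range N).2 AN.
set c := \sum_(m < N) A m in IHN *.
suff -> : c = n1 by rewrite addn1 !ltnS -an1 leE.
apply/eqP; rewrite eqn_leq leqNgt -IHN an1 ltnn /= leqNgt.
by apply/negP => /a_incr; rewrite an1 IHN ltnn.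
Qed.

Lemma inverse_support_even (u : fps 'F_2) m :
  is_comp_inverse period_doubling_series u -> ~~ odd m -> u m = 0%R.
Proof. by move=> hu em; apply: (cons1_odd (n := m.+1) hu). Qed.

(** The odd number 2 m - 1 is in the support exactly when m is in W; the
    successor accounts for 0, which is in W but corresponds to no support
    element. *)
Lemma inverse_support_count (u : fps 'F_2) M :
  is_comp_inverse period_doubling_series u ->
  (\sum_(m < (2 * M).+1) (u m == 1%R)).+1 =
  \sum_(m < M.+1) (cons1 u (2 * m) == 1%R).
Proof.
move=> hu; elim: M => [|M IHM].
  by rewrite !big_ord1 (inverse_support_even hu).
rewrite mulnS addSn addSn add0n big_ord_recr /= [RHS]big_ord_recr /= -IHM.
rewrite big_ord_recr /= [X in _ + X](_ : _ = 0); last first.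
  by rewrite (inverse_support_even hu) //=; lia.
by rewrite addn0 -addSn; congr (_ + (u _ == 1%R)); lia.
Qed.

(** a_n = 2 m - 1 with m in W, and counting shows that m has L + 1 binary
    digits, so that m mod 3 is known. *)
Lemma inverse_enum_mod3 (u : fps 'F_2) (a : nat -> nat) L n :
  is_comp_inverse period_doubling_series u ->
  {homo a : m n / m < n} ->
  (forall m, (exists n, a n = m) <-> u m = 1%R) ->
  fib L.+2 <= n.+1 < fib L.+3 -> a n %% 3 = if odd L then 2 else 1.
Proof.
move=> hu a_incr a_range; pose w m := cons1 u (2 * m) == 1%R.
have ss : even_zero_runs w := inverse_even_zero_runs hu.
have a_range' m : (exists n, a n = m) <-> (u m == 1%R).
  by rewrite a_range; split=> /eqP.
have aE M : (a n < (2 * M).+1) = (n.+1 < \sum_(m < M.+1) w m).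
  rewrite (leq_enum (A := fun m => u m == 1%R) a_incr a_range').
  by rewrite -(inverse_support_count M hu).
have powE K : (a n < (2 * 2 ^ K).-1) = (n.+1 < fib K.+2).
  have K0 : 0 < 2 ^ K by rewrite expn_gt0.
  rewrite -(count_pow2 _ ss) -(prednK K0) -aE; congr (_ < _); lia.
have ua : u (a n) = 1%R by apply/a_range; exists n.
have odda : odd (a n).
  by apply: contraTT isT => /(inverse_support_even hu); rewrite ua => /eqP.
have aE2 : (a n).+1 = 2 * (a n).+1./2 by lia.
have wa : w (a n).+1./2 by rewrite /w -aE2 /= ua.
rewrite -[fib L.+2 <= _]negbK -ltnNge -!powE => bn.
have := mod3_parity_of_length (L := L) ss wa.
rewrite expnS in bn *.
move=> h; have {}h : (a n).+1./2 %% 3 = ~~ odd L by apply: h; lia.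
by move: h; case: (odd L) => /=; lia.
Qed.

(** * Consequence of regularity *)

(** Modulo q, the kernel sequences with remainder 0 are combinations of N fixed
    sequences with coefficients in a finite ring, so two of them agree. *)
Lemma k_regular_mod k q (s : nat -> nat) :
  0 < k -> 1 < q -> k_regular k (fun n => (s n)%:Z%R) ->
  exists i d, 0 < d /\ forall n, s (k ^ i * n) = s (k ^ (i + d) * n) %[mod q].
Proof.
move=> k_gt0 q_gt1 [N [S gen]].
have ex i : exists c : {ffun 'I_N -> 'Z_q},
    forall n, ((s (k ^ i * n)%N)%:R = \sum_(j < N) c j * (S j n)%:~R :> 'Z_q)%R.
  have [|c cE] := gen (fun n => (s (k ^ i * n)%N)%:Z%R).
    by exists i, 0; rewrite expn_gt0 k_gt0; split=> // n; rewrite addn0.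
  exists [ffun j => (c j)%:~R]%R => n.
  rewrite pmulrn cE rmorph_sum /=; apply: eq_bigr => j _.
  by rewrite ffunE rmorphM.
have [c cE] := fin_all_exists
  (fun i : 'I_(#|{ffun 'I_N -> 'Z_q}|.+1) => ex i).
have /injectivePn[x [y nxy cxy]] : ~~ injectiveb c.
  by apply/negP => /injectiveP/leq_card; rewrite card_ord ltnn.
wlog ltxy : x y nxy cxy / x < y.
  move=> th; have [lt|] := ltnP x y; first exact: (th x y).
  rewrite leq_eqVlt => /orP[/eqP/val_inj eyx|lt].
    by rewrite eyx eqxx in nxy.
  by apply: (th y x); rewrite // eq_sym.
exists (val x), (y - x); split=> [|n]; first by rewrite subn_gt0.
rewrite subnKC 1?ltnW // -!val_Zp_nat //; congr (val _).
by rewrite !cE cxy.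
Qed.

(** * Fibonacci blocks are not invariant under scaling *)

(** Two consecutive terms that are nonnegative, the second one positive, make
    the sequence grow without bound, and likewise for the opposite sequence.  So
    signs alternate, and then |e_t| = |e_(t+1)| + |e_(t+2)| makes the absolute
    values decrease forever unless they are 0. *)
Lemma bounded_fibonacci_eq0 (e : nat -> int) (C : int) :
  (forall t, e t.+2 = e t.+1 + e t)%R -> (forall t, - C <= e t <= C)%R ->
  forall t, e t = 0%R.
Proof.
move=> rec bnd.
have grow (f : nat -> int) : (forall t, f t.+2 = f t.+1 + f t)%R ->
    (forall t, f t <= C)%R -> forall t, (0 <= f t -> f t.+1 <= 0)%R.
  move=> frec fC t ft; suff: ~ (1 <= f t.+1)%R by lia.
  move=> ft1.
  have gr n : (1 <= f (t + n.+1)%N /\ f t.+1 + n%:Z <= f (t + n.+2)%N)%R.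
    elim: n => [|n [IH1 IH2]]; first by rewrite addn1 addn2 frec; lia.
    split; first by lia.
    by rewrite !addnS frec -!addnS; lia.
  by have [] := gr (absz C); have := fC (t + (absz C).+2); lia.
have nrec t : (- e t.+2 = - e t.+1 + - e t)%R by rewrite rec; lia.
have neg t : (- e t <= C)%R by have := bnd t; lia.
have pos t : (e t <= C)%R by have := bnd t; lia.
have alt1 := grow e rec pos.
have alt2 := grow (fun t => - e t)%R nrec neg.
have dec t : (e t != 0 -> `|e t.+2| + 1 <= `|e t| /\ e t.+2 != 0)%R.
  move: (alt1 t) (alt1 t.+2) (alt1 t.+3) (alt2 t) (alt2 t.+2) (alt2 t.+3).
  by move: (rec t) (rec t.+1) (rec t.+2) => /=; lia.
have desc n t : (e t != 0 -> n%:Z <= `|e t|)%R.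
  by elim: n t => [|n IHn] t /dec; [lia|case=> + /IHn; lia].
by move=> t; apply/eqP/negPn/negP => /(desc `|e t|.+1); lia.
Qed.

(** If fib x_j is within C of K fib j for all large j, then x_(j+1) = x_j + 1
    for large j: adding two consecutive approximations approximates the next
    one, so a larger gap would leave a Fibonacci number of bounded size
    in a place where all of them are large. *)
Lemma fib_scale_rigid K C : 1 < K ->
  (forall j, C <= fib j ->
    exists x, fib x <= K * fib j + C /\ K * fib j <= fib x + C) ->
  False.
Proof.
move=> K_gt1; pose near x j := fib x <= K * fib j + C /\ K * fib j <= fib x + C.
move=> ex; have ex_near j : C <= fib j -> exists x, near x j := ex j.
(* Large enough for the errors, at most 3 C in total, to be negligible. *)
pose J := (8 * C + 8).+1.
have large j : J <= j -> 8 * C + 8 <= fib j.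
  by move=> leJ; apply: leq_trans (fib_homo leJ); apply: fib_large.
have near_ltn j x y : J <= j -> near x j.+1 -> near y j.+2 -> x < y.
  move=> /large lej [x1 x2] [y1 y2]; rewrite ltnNge; apply/negP => /fib_homo.
  by rewrite fibSS mulnDr in y2; nia.
have near_succ j x y : J <= j -> near x j.+1 -> near y j.+2 -> y = x.+1.
  move=> leJ nx ny; have ltxy := near_ltn _ _ _ leJ nx ny.
  apply/eqP; rewrite eqn_leq ltxy andbT leqNgt; apply/negP => gty.
  have lej1 := large _ (leqW leJ).
  have [|z nz] := ex_near j.+3; first by have := large j.+3; lia.
  have /fib_homo := near_ltn _ _ _ (leqW leJ) ny nz.
  case: nx ny nz => x1 x2 [y1 y2] [z1 z2].
  case: y gty {ltxy} y1 y2 => // y; rewrite ltnS => /fib_homo gty y1 y2.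
  rewrite !fibSS in gty *; rewrite (fibSS j.+1) mulnDr in z1.
  have leK : 2 * fib j.+1 <= K * fib j.+1 by rewrite leq_mul2r K_gt1 orbT.
  have f0 : fib 0 = 0 := erefl; have f1 : fib 1 = 1 := erefl.
  case: x x1 x2 gty => [|[|x]] x1 x2 gty; [lia|lia|].
  by have := fib_leS x; rewrite !fibSS in x1 x2 gty *; lia.
have [|x0 nx0] := ex_near J.+1; first by have := large J.+1; lia.
have near_t t : near (x0 + t) (J.+1 + t).
  elim: t => [|t IHt]; first by rewrite !addn0.
  have [|y ny] := ex_near (J.+1 + t.+1).
    by have := large (J.+1 + t.+1); lia.
  rewrite addnS in ny *.
  by rewrite addnS -(near_succ (J + t) _ _ (leq_addr _ _) IHt ny).
pose e t : int := ((fib (x0 + t))%:Z - (K * fib (J.+1 + t))%:Z)%R.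
have e0 : forall t, e t = 0%R.
  apply: (@bounded_fibonacci_eq0 e C%:Z) => t.
    by rewrite /e !addnS !fibSS mulnDr; lia.
  by have [] := near_t t; rewrite /e; lia.
have dvdK t : K %| fib (x0 + t).
  by apply/dvdnP; exists (fib (J.+1 + t)); have := e0 t; rewrite /e; lia.
have := coprime_fib x0; rewrite /coprime => /eqP gcd1.
have : K %| gcdn (fib x0) (fib x0.+1).
  by rewrite dvdn_gcd -{1}[x0]addn0 -[x0.+1]addn1 !dvdK.
by rewrite gcd1 dvdn1; lia.
Qed.

(** A block boundary fib j separates B n + 1 from B (n + 1) + 1 for some n, so
    s changes between B n and B (n + 1).  It then changes between B K n and
    B K (n + 1) too, which requires a boundary fib x between B K n + 1 and
    B K (n + 1) + 1, hence within 4 K B of K fib j. *)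
Lemma fib_parity_rigid (s : nat -> bool) B K : 0 < B -> 1 < K ->
  (forall L n, fib L.+2 <= n.+1 < fib L.+3 -> s n = odd L) ->
  (forall n, s (B * n) = s (B * K * n)) -> False.
Proof.
move=> B_gt0 K_gt1 sP sK; apply: (@fib_scale_rigid K (4 * (K * B))) => // j.
have B2 : 2 * B <= K * B by rewrite leq_mul2r K_gt1 orbT.
have f0 : fib 0 = 0 := erefl; have f1 : fib 1 = 1 := erefl.
have f2 : fib 2 = 1 := erefl.
case: j => [|[|[|j]]] Cj; [lia|lia|lia|]; set F := fib j.+3 in Cj *.
have FE : F = fib j.+2 + fib j.+1 := erefl.
have lej := fib_leS j; have lej1 := fib_leS j.+1; have FS := fibSS j.
have FSS : fib j.+4 = F + fib j.+2 := erefl.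
have leB : B <= fib j.+1 by lia.
(* The largest n with B n + 1 < F. *)
pose n := (F - 2) %/ B.
have n1 : B * n <= F - 2 by rewrite mulnC leq_divM.
have n2 : F - 2 < B * n.+1 by rewrite mulnC ltn_ceil.
rewrite mulnS in n2.
have s1 : s (B * n) = odd j by apply: sP; rewrite -/F; lia.
have s2 : s (B * n.+1) = odd j.+1.
  by apply: sP; rewrite -/F FSS mulnS; lia.
have [L1 b1] := fib_level (ltn0Sn (B * K * n)).
have [L2 b2] := fib_level (ltn0Sn (B * K * n.+1)).
have neqL : L1 != L2.
  apply/eqP => eL; move: s1 s2; rewrite !sK (sP _ _ b1) (sP _ _ b2) eL => -> /=.
  by case: (odd j).
have ltL : L1 < L2.
  rewrite ltn_neqAle neqL leqNgt; apply/negP => ltL.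
  have leF : fib L2.+3 <= fib L1.+2 by apply: fib_homo; lia.
  have : B * K * n <= B * K * n.+1 by rewrite leq_mul2l leqnSn orbT.
  by lia.
have leF : fib L1.+3 <= fib L2.+2 by apply: fib_homo; lia.
have m1 : K * (B * n) <= K * (F - 2) by rewrite leq_mul2l n1 orbT.
have m2 : K * (F - 2) <= K * (B + B * n) by rewrite leq_mul2l ltnW ?orbT.
have F2 : 2 <= F by lia.
have EK : K * F = K * (F - 2) + K * 2 by rewrite -mulnDr subnK.
have E1 : B * K * n = K * (B * n) by rewrite mulnA [B * K]mulnC.
have E2 : B * K * n.+1 = K * (B * n) + K * B.
  by rewrite mulnS E1 [B * K]mulnC addnC.
have K2 : K <= K * B by rewrite -{1}[K]muln1 leq_mul2l B_gt0 orbT.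
by exists L1.+3; rewrite mulnDr in m2; lia.
Qed.

Local Close Scope nat_scope.

Theorem corollary28 (u : fps 'F_2)
    (hu : is_comp_inverse period_doubling_series u)
    (a : nat -> nat)
    (a_incr : {homo a : m n / (m < n)%N})
    (a_range : forall m : nat, (exists n : nat, a n = m) <-> u m = 1)
    (k : nat) (hk : (2 <= k)%N) :
  ~ k_regular k (fun n => (a n)%:Z).
Proof.
have k_gt0 : (0 < k)%N by apply: ltnW.
move=> /(k_regular_mod (q := 3) k_gt0 isT)[i [d [d_gt0 ad]]].
apply: (@fib_parity_rigid (fun n => a n %% 3 == 2)%N (k ^ i)%N (k ^ d)%N).
- by rewrite expn_gt0 k_gt0.
- by rewrite -(expn0 k) ltn_exp2l.
- by move=> L n /(inverse_enum_mod3 hu a_incr a_range) ->; case: (odd L).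
- by move=> n; rewrite ad expnD.
Qed.
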